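(* Let $G$ be a group, $A \leq G$ a subgroup, $H$ a given $A$-complement of $G$, and $(A, H, \triangleright, \triangleleft)$ the canonical matched pair associated to the factorization $G = AH$. Then: (1) The relation $\sim$ (equivalence of deformation maps) is an equivalence relation on the set $\mathcal{DM}(H, A \mid (\triangleright, \triangleleft))$ of all deformation maps of $(A, H, \triangleright, \triangleleft)$, and the map $$\mathcal{D}(H, A \mid (\triangleright, \triangleleft)) \to \mathcal{F}(A, G), \qquad \overline{r} \mapsto H_r$$ (sending the class $\overline{r}$ of $r$ to the isomorphism type of the group $H_r$) is a bijection of sets, where $\mathcal{D}(H, A \mid (\triangleright, \triangleleft)) := \mathcal{DM}(H, A \mid (\triangleright, \triangleleft))/\!\sim$ is the quotient set and $\overline{r}$ is the equivalence class of $r$ under $\sim$. (2) The factorization index of $A$ in $G$ is given by $$[G : A]^f = |\mathcal{D}(H, A \mid (\triangleright, \triangleleft))| .$$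
   Context: Complement and factorization index: for a subgroup $A \leq G$, an $A$-complement of $G$ is a subgroup $H \leq G$ with $G = AH$ and $A \cap H = \{1\}$. $\mathcal{F}(A, G)$ denotes the set of isomorphism types (isomorphism classes, as abstract groups) of all $A$-complements of $G$, and the factorization index is the cardinal $[G : A]^f := |\mathcal{F}(A, G)|$. Matched pair: a matched pair of groups is a quadruple $(A, H, \triangleright, \triangleleft)$ where $A$, $H$ are groups, $\triangleright : H \times A \to A$ is a left action of the group $H$ on the set $A$, and $\triangleleft : H \times A \to H$ is a right action of the group $A$ on the set $H$, such that for all $a, b \in A$ and $h, g \in H$: $$h \triangleright (ab) = (h \triangleright a)\,((h \triangleleft a) \triangleright b), \qquad (hg) \triangleleft a = (h \triangleleft (g \triangleright a))\,(g \triangleleft a).$$ Canonical matched pair: if $H$ is an $A$-complement of $G$, then for all $a \in A$, $h \in H$ there is a unique pair $(h \triangleright a,\, h \triangleleft a) \in A \times H$ such that $h a = (h \triangleright a)(h \triangleleft a)$ in $G$; this defines a matched pair $(A, H, \triangleright, \triangleleft)$, called the canonical matched pair associated to the factorization $G = AH$. Deformation map: a deformation map of the matched pair $(A, H, \triangleright, \triangleleft)$ is a function $r : H \to A$ with $r(1) = 1$ and, for all $g, h \in H$, $$r\bigl((h \triangleleft r(g))\, g\bigr) = r(h)\,(h \triangleright r(g)).$$ $r$-deformation: for a deformation map $r$, $H_r$ denotes the group with underlying set $H$ and multiplication $h \bullet g := (h \triangleleft r(g))\, g$ (this is a group, isomorphic to an $A$-complement of $G$). Equivalence: two deformation maps $r,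 R : H \to A$ are called equivalent, written $r \sim R$, if there exists a permutation $\sigma : H \to H$ of the set $H$ such that $\sigma(1) = 1$ and, for all $g, h \in H$, $$\sigma\bigl((h \triangleleft r(g))\, g\bigr) = \bigl(\sigma(h) \triangleleft R(\sigma(g))\bigr)\, \sigma(g).$$ *)

(* Defs.v *)
From HB Require Import structures.
From mathcomp Require Import all_boot.
From mathcomp Require Import boolp classical_sets functions cardinality.

Set Implicit Arguments.
Unset Strict Implicit.
Unset Printing Implicit Defensive.

Local Open Scope classical_set_scope.
Local Open Scope group_scope.
Local Open Scope card_scope.

(* Subgroups of an arbitrary group G are terms of groupClosed G, i.e. boolean
   predicates closed under the group operations; the logic being classical,
   every subset of G is of this form. *)
Definition subgroup (G : groupType) (A : groupClosed G) := {x : G | x \in A}.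

Section Subgroup.
Variables (G : groupType) (A : groupClosed G).

Lemma subgroup_closed : group_closed [pred x : G | x \in A].
Proof.
by split=> [|x y /= xA yA]; rewrite !inE; [exact: gpred1 | exact: gpredF].
Qed.

HB.instance Definition _ := SubChoice.on (subgroup A).
HB.instance Definition _ :=
  SubChoice_isSubGroup.Build G _ (subgroup A) subgroup_closed.
End Subgroup.

Definition is_complement (G : groupType) (A H : groupClosed G) : Prop :=
  (forall x : G, exists a h, [/\ a \in A, h \in H & x = a * h]) /\
  (forall x : G, x \in A -> x \in H -> x = 1).

Definition isomorphic (K L : groupType) : Prop :=
  exists f : {multiplicative K -> L}, bijective f.

(* The isomorphism type of a group K, among the A-complements of G: since the
   class of all groups isomorphic to K does not fit in the universe of set,
   the type of K is represented by the set of those A-complements which are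
   isomorphic to K. When K is isomorphic to an A-complement this is a nonempty
   set that determines K up to isomorphism. It is empty otherwise, and then it
   is not a member of complement_types A. *)
Definition iso_type (G : groupType) (A : groupClosed G) (K : groupType) :
  set (groupClosed G) := [set L | is_complement A L /\ isomorphic K (subgroup L)].

(* F(A, G): the isomorphism types of all the A-complements of G. *)
Definition complement_types (G : groupType) (A : groupClosed G) :
  set (set (groupClosed G)) :=
  [set iso_type A (subgroup K) | K in [set K : groupClosed G | is_complement A K]].

Record matched_pair (A H : groupType) := MatchedPair {
  lact : H -> A -> A;
  ract : H -> A -> H;
  lact1 : forall a, lact 1 a = a;
  lactM : forall h g a, lact (h * g) a = lact h (lact g a);
  ract1 : forall h, ract h 1 = h;
  ractM : forall h a b, ract h (a * b) = ract (ract h a) b;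
  lact_mulr : forall h a b, lact h (a * b) = lact h a * lact (ract h a) b;
  ract_mull : forall h g a, ract (h * g) a = ract h (lact g a) * ract g a
}.

Section CanonicalMatchedPair.
Variables (G : groupType) (A H : groupClosed G) (cAH : is_complement A H).

Lemma factor_ex (x : G) :
  exists p : subgroup A * subgroup H, x = val p.1 * val p.2.
Proof.
have [a [h [aA hH ->]]] := cAH.1 x.
by exists (exist _ a aA, exist _ h hH).
Qed.

Definition factor (x : G) : subgroup A * subgroup H := projT1 (cid (factor_ex x)).

Lemma factorE x : val (factor x).1 * val (factor x).2 = x.
Proof. by rewrite /factor; case: cid. Qed.

Lemma factor_inj (a b : subgroup A) (h g : subgroup H) :
  val a * val h = val b * val g -> a = b /\ h = g.
Proof.
move=> e.
have e1 : (val b)^-1 * val a = val g * (val h)^-1.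
  by apply: (can_inj (mulgK (val h))); rewrite mulgVK -mulgA e mulKg.
have e2 : (val b)^-1 * val a = 1.
  apply: cAH.2; first by rewrite gpredM ?gpredV ?(valP a) ?(valP b).
  by rewrite e1 gpredM ?gpredV ?(valP h) ?(valP g).
have eab : a = b.
  by apply: val_inj; apply: (can_inj (mulKg (val b)^-1)); rewrite e2 mulVg.
split=> //; apply: val_inj; move: e; rewrite eab.
exact: (can_inj (mulKg (val b))).
Qed.

Definition can_lact (h : subgroup H) (a : subgroup A) : subgroup A :=
  (factor (val h * val a)).1.
Definition can_ract (h : subgroup H) (a : subgroup A) : subgroup H :=
  (factor (val h * val a)).2.

Lemma can_actE (h : subgroup H) (a : subgroup A) :
  val h * val a = val (can_lact h a) * val (can_ract h a).
Proof. by rewrite /can_lact /can_ract factorE. Qed.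

Lemma can_act_uniq (h g : subgroup H) (a b : subgroup A) :
  val h * val a = val b * val g -> can_lact h a = b /\ can_ract h a = g.
Proof. by rewrite can_actE => /factor_inj. Qed.

Lemma can_act1l a : can_lact 1 a = a /\ can_ract 1 a = 1.
Proof. by apply: can_act_uniq; rewrite !gmulf1 mulg1 mul1g. Qed.

Lemma can_act1r h : can_lact h 1 = 1 /\ can_ract h 1 = h.
Proof. by apply: can_act_uniq; rewrite !gmulf1 mulg1 mul1g. Qed.

Lemma can_actMl h g a :
  can_lact (h * g) a = can_lact h (can_lact g a) /\
  can_ract (h * g) a = can_ract h (can_lact g a) * can_ract g a.
Proof.
apply: can_act_uniq.
by rewrite !gmulfM -mulgA (can_actE g a) mulgA (can_actE h) mulgA.
Qed.

Lemma can_actMr h a b :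
  can_lact h (a * b) = can_lact h a * can_lact (can_ract h a) b /\
  can_ract h (a * b) = can_ract (can_ract h a) b.
Proof.
apply: can_act_uniq.
by rewrite !gmulfM mulgA (can_actE h a) -mulgA (can_actE _ b) mulgA.
Qed.

Definition canonical_matched_pair :
    matched_pair (subgroup A) (subgroup H) :=
  {| lact := can_lact;
     ract := can_ract;
     lact1 := fun a => (can_act1l a).1;
     lactM := fun h g a => (can_actMl h g a).1;
     ract1 := fun h => (can_act1r h).2;
     ractM := fun h a b => (can_actMr h a b).2;
     lact_mulr := fun h a b => (can_actMr h a b).1;
     ract_mull := fun h g a => (can_actMl h g a).2 |}.

End CanonicalMatchedPair.

Record deformation (A H : groupType) (MP : matched_pair A H) := Deformation {
  deform :> H -> A;
  deform1 : deform 1 = 1;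
  deformM : forall g h,
    deform (ract MP h (deform g) * g) = deform h * lact MP h (deform g)
}.

Definition deformed (A H : groupType) (MP : matched_pair A H)
  (r : deformation MP) : Type := H.

Section Deformed.
Variables (A H : groupType) (MP : matched_pair A H) (r : deformation MP).

Definition deformed_mul (h g : H) : H := ract MP h (r g) * g.
Definition deformed_inv (g : H) : H := ract MP g^-1 (r g)^-1.

Lemma ract_1 a : ract MP 1 a = 1.
Proof.
have := ract_mull MP 1 1 a; rewrite mulg1 lact1 => e.
by apply: (can_inj (mulKg (ract MP 1 a))); rewrite -e mulg1.
Qed.

Lemma deformed_mulA : associative deformed_mul.
Proof.
move=> h g k; rewrite /deformed_mul deformM ract_mull ractM.
by rewrite mulgA.
Qed.

Lemma deformed_mul1 : left_id 1 deformed_mul.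
Proof. by move=> g; rewrite /deformed_mul ract_1 mul1g. Qed.

Lemma deformed_mulr1 : right_id 1 deformed_mul.
Proof. by move=> g; rewrite /deformed_mul deform1 ract1 mulg1. Qed.

Lemma deformed_mulV : left_inverse 1 deformed_inv deformed_mul.
Proof.
by move=> g; rewrite /deformed_mul /deformed_inv -ractM mulVg ract1 mulVg.
Qed.

Lemma deformed_mulrV : right_inverse 1 deformed_inv deformed_mul.
Proof.
move=> g; set g' := deformed_inv g; set g'' := deformed_inv g'.
rewrite -[deformed_mul g g']deformed_mul1 -{1}(deformed_mulV g').
by rewrite -deformed_mulA [deformed_mul g' _]deformed_mulA deformed_mulV
           deformed_mul1 deformed_mulV.
Qed.

HB.instance Definition _ := Choice.copy (deformed r) H.
HB.instance Definition _ := isGroup.Build (deformed r)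
  deformed_mulA deformed_mul1 deformed_mulr1 deformed_mulV deformed_mulrV.

End Deformed.

Section Equivalence.
Variables (A H : groupType) (MP : matched_pair A H).

Definition deform_equiv (r R : deformation MP) : Prop :=
  exists sigma : H -> H,
    [/\ bijective sigma, sigma 1 = 1 &
        forall g h, sigma (ract MP h (r g) * g) =
                    ract MP (sigma h) (R (sigma g)) * sigma g].

Definition deform_class (r : deformation MP) : set (deformation MP) :=
  [set R | deform_equiv r R].

Definition deform_quotient : set (set (deformation MP)) := range deform_class.

End Equivalence.

Arguments deform_equiv {A H} MP r R.
Arguments deform_quotient {A H} MP.

(* Main.v *)
Require Import Defs.
From HB Require Import structures.
From Stdlib Require Import RelationClasses.
From mathcomp Require Import all_boot.
From mathcomp Require Import boolp classical_sets functions cardinality.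

(** Complements of [A] are graphs over [H].  Every right coset of [A]
    meets a complement [K] exactly once, so each [h] in [H] can be corrected by a unique
    factor [r h] in [A] to land in [K], and [h |-> r h * h] is a bijection from
    [H] onto [K].  In [G],

      [r h * h * (r g * g) = r h * (h |> r g) * ((h <| r g) * g)],

    whose second factor [(h <| r g) * g] is the product of [h] and [g] in the
    [r]-deformation of [H].  Hence closure of [K] under multiplication says
    exactly that [r] is a deformation map, and [h |-> r h * h] is then an
    isomorphism from the deformed group onto [K].  So every deformation is
    isomorphic to a complement ([deformed_iso_complement]) and every complement
    to a deformation ([complement_iso_deformed]).

    Equivalence of [r] and [R] is, after unfolding, isomorphism of the two
    deformed groups ([deform_equivP]).  It is therefore an equivalence relation,
    and sending [r] to the isomorphism type of its deformation identifies
    exactly the equivalent maps, which is injectivity on the quotient;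
    surjectivity is the realization of complements.  The equality of cardinals
    is read off the bijection. *)

Set Implicit Arguments.
Unset Strict Implicit.
Unset Printing Implicit Defensive.

Local Open Scope classical_set_scope.
Local Open Scope card_scope.

(** * Isomorphism of groups *)

Section Isomorphic.
Local Open Scope group_scope.

Lemma isomorphic_of_bij (K L : groupType) (f : K -> L) :
  {morph f : x y / x * y} -> bijective f -> isomorphic K L.
Proof.
move=> fM f_bij.
pose F := HB.pack_for {multiplicative K -> L} f
  (isMultiplicative.Build K L f fM).
by exists F.
Qed.

Lemma isomorphic_refl (K : groupType) : isomorphic K K.
Proof. by apply: (@isomorphic_of_bij K K id) => //; exists id. Qed.

Lemma isomorphic_sym (K L : groupType) : isomorphic K L -> isomorphic L K.
Proof.
move=> [f [g fK gK]]; apply: (isomorphic_of_bij (can2_gmulfM fK gK)).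
by exists f.
Qed.

Lemma isomorphic_trans (K L M : groupType) :
  isomorphic K L -> isomorphic L M -> isomorphic K M.
Proof.
move=> [f f_bij] [g g_bij]; apply: (@isomorphic_of_bij _ _ (g \o f)).
  by move=> x y /=; rewrite !gmulfM.
exact: bij_comp.
Qed.

Lemma morph_group1 (K L : groupType) (f : K -> L) :
  {morph f : x y / x * y} -> f 1 = 1.
Proof.
by move=> fM; apply: (can_inj (mulKg (f 1))); rewrite -fM !mulg1.
Qed.

End Isomorphic.

(** * Isomorphism types of complements *)

Section IsoType.
Variables (G : groupType) (A : groupClosed G).

Lemma iso_type_isomorphic (K L : groupType) :
  isomorphic K L -> iso_type A K = iso_type A L.
Proof.
move=> KL; apply/seteqP; split=> M [cM].
- by move=> KM; split=> //; apply: isomorphic_trans KM; apply: isomorphic_sym.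
- by move=> LM; split=> //; apply: isomorphic_trans LM.
Qed.

(** If [K] is isomorphic to a complement, that complement belongs to
    [iso_type A K], which is why the set remembers [K]. *)
Lemma iso_type_inj (K L : groupType) (C : groupClosed G) :
  is_complement A C -> isomorphic K (subgroup C) ->
  iso_type A K = iso_type A L -> isomorphic K L.
Proof.
move=> cC KC e.
have [_ LC] : iso_type A L C by rewrite -e.
exact: isomorphic_trans KC (isomorphic_sym LC).
Qed.

End IsoType.

(** * Equivalent deformation maps *)

Section DeformEquiv.
Local Open Scope group_scope.
Variables (A H : groupType) (MP : matched_pair A H).

(** The identity required of [sigma] is multiplicativity for the deformed
    products, and [sigma 1 = 1] holds for every group morphism. *)
Lemma deform_equivP (r R : deformation MP) :
  deform_equiv MP r R <-> isomorphic (deformed r) (deformed R).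
Proof.
split=> [[s [s_bij _ sM]] | [s s_bij]].
- apply: (@isomorphic_of_bij (deformed r) (deformed R) s) => // h g.
  exact: sM.
- exists s; split=> //.
    exact: (@morph_group1 (deformed r) (deformed R) s (@gmulfM _ _ s)).
  by move=> g h; apply: (@gmulfM _ _ s).
Qed.

Lemma deform_equiv_equivalence : Equivalence (deform_equiv MP).
Proof.
split=> [r | r R /deform_equivP rR | r R Q /deform_equivP rR /deform_equivP RQ];
  apply/deform_equivP.
- exact: isomorphic_refl.
- exact: isomorphic_sym.
- exact: isomorphic_trans RQ.
Qed.

Lemma deform_class_eq (r R : deformation MP) :
  deform_equiv MP r R -> deform_class r = deform_class R.
Proof.
case: deform_equiv_equivalence => _ symE transE rR.
apply/seteqP; split=> Q /= hQ; first exact: transE (symE _ _ rR) hQ.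
exact: transE rR hQ.
Qed.

End DeformEquiv.

(** * The image of a group morphism as a subgroup *)

Section MorphImage.
Local Open Scope group_scope.
Variables (K G : groupType) (f : K -> G).
Hypothesis fM : {morph f : x y / x * y}.

Lemma morph_image_closed :
  exists C : groupClosed G, forall x, (x \in C) <-> (exists k, x = f k).
Proof.
pose S : pred G := fun x => `[< exists k, x = f k >].
have SP x : reflect (exists k, x = f k) (x \in S) by apply: asboolP.
have S1 : 1 \in S by apply/SP; exists 1; rewrite (morph_group1 fM).
have SM : {in S &, forall x y, x * y \in S}.
  move=> x y /SP[k ->] /SP[l ->]; by apply/SP; exists (k * l); rewrite fM.
have SV : {in S, forall x, x^-1 \in S}.
  move=> x /SP[k ->]; apply/SP; exists k^-1; apply/esym.
  by apply: (can_inj (mulKg (f k))); rewrite -fM !mulgV (morph_group1 fM).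
pose C := HB.pack_for (groupClosed G) S (isInvClosed.Build G S SV)
  (isMul1Closed.Build G S S1) (isMulClosed.Build G S SM).
by exists C => x; split=> /SP.
Qed.

End MorphImage.

(** * Complements and deformations of the canonical matched pair *)

Section Complements.
Local Open Scope group_scope.
Variables (G : groupType) (A H : groupClosed G) (cAH : is_complement A H).
Let MP := canonical_matched_pair cAH.

(** By uniqueness of factorization, the product of two points of the graph of
    [r] can lie on that graph only over the deformed product, and it does exactly
    when [r] satisfies the deformation identity. *)
Lemma graph_mul (r : subgroup H -> subgroup A) (h g : subgroup H) :
  val (r h) * val h * (val (r g) * val g) =
  val (r h * lact MP h (r g)) * val (ract MP h (r g) * g).
Proof.
by rewrite !gmulfM !mulgA -(mulgA (val (r h))) (can_actE cAH) !mulgA.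
Qed.

Definition deform_graph (r : deformation MP) (h : deformed r) : G :=
  val (r h) * val (h : subgroup H).

Lemma deform_graphM (r : deformation MP) :
  {morph @deform_graph r : x y / x * y}.
Proof.
by move=> h g; rewrite [RHS](graph_mul r h g) -deformM.
Qed.

Lemma deform_graph_inj (r : deformation MP) : injective (@deform_graph r).
Proof. by move=> h g /(factor_inj cAH)[]. Qed.

Lemma deformed_iso_complement (r : deformation MP) :
  exists2 C : groupClosed G,
    is_complement A C & isomorphic (deformed r) (subgroup C).
Proof.
have [C CP] := morph_image_closed (@deform_graphM r).
have fC (h : deformed r) : deform_graph h \in C by apply/CP; exists h.
exists C.
  split=> [x | _ /[swap] /CP[h ->] fA].
  - pose a := (factor cAH x).1; pose h : deformed r := (factor cAH x).2.
    exists (val a * (val (r h))^-1), (deform_graph h).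
    split=> //; first by rewrite gpredM ?gpredV ?(valP a) ?(valP (r h)).
    by rewrite /deform_graph mulgA mulgVK; apply/esym/factorE.
  (* a point [r h * h] of the graph lying in [A] has [h] in [A] too, so [h = 1] *)
  - have hA : val (h : subgroup H) \in A.
      by rewrite -(mulKg (val (r h)) (val _)) gpredM ?gpredV ?(valP (r h)).
    have -> : h = 1.
      by apply: val_inj; apply: (cAH.2 _ hA); apply: (valP (h : subgroup H)).
    exact: morph_group1 (@deform_graphM r).
pose f (h : deformed r) : subgroup C := exist _ (deform_graph h) (fC h).
apply: (@isomorphic_of_bij _ _ f).
  by move=> h g; apply: val_inj; rewrite gmulfM; apply: deform_graphM.
have g_ex (y : subgroup C) : exists h : deformed r, val y = deform_graph h.
  exact/CP/(valP y).
have [g gP] := choice g_ex.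
exists g => [h | y].
- by apply: deform_graph_inj; rewrite -gP.
- by apply: val_inj; rewrite /= -gP.
Qed.

(** The deformation map attached to a complement [K]: if [h = a * k] with [a] in
    [A] and [k] in [K], the factor correcting [h] into [K] is [a^-1]. *)
Lemma complement_iso_deformed (K : groupClosed G) : is_complement A K ->
  exists r : deformation MP, isomorphic (deformed r) (subgroup K).
Proof.
move=> cAK.
pose r (h : subgroup H) : subgroup A := (factor cAK (val h)).1^-1.
pose s (h : subgroup H) : subgroup K := (factor cAK (val h)).2.
have sE h : val (s h) = val (r h) * val h.
  by rewrite -[in RHS](factorE cAK (val h)) gmulfV mulKg.
(* [h = (r h)^-1 * s h] is the factorization of [h] along [K], and it is unique *)
have rs_uniq h a k : val k = val a * val h -> r h = a /\ s h = k.
  move=> e.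
  have /(factor_inj cAK)[eA eK] :
      val (r h)^-1 * val (s h) = val a^-1 * val k.
    by rewrite sE e !gmulfV !mulKg.
  by split=> //; apply: invg_inj.
have rsM g h : r (ract MP h (r g) * g) = r h * lact MP h (r g) /\
               s (ract MP h (r g) * g) = s h * s g.
  by apply: rs_uniq; rewrite -graph_mul -!sE gmulfM.
have r1 : r 1 = 1 by apply: (rs_uniq 1 1 1 _).1; rewrite !gmulf1 mulg1.
pose rd := Deformation r1 (fun g h => (rsM g h).1).
exists rd; apply: (@isomorphic_of_bij (deformed rd) _ s).
  by move=> h g; apply: (rsM g h).2.
exists (fun k => (factor cAH (val k)).2) => [h | k].
- apply: (factor_inj cAH (a := (factor cAH (val (s h))).1) (b := r h) _).2.
  by rewrite factorE sE.
- set a := (factor cAH (val k)).1.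
  by apply: (rs_uniq _ a k _).2; rewrite factorE.
Qed.

(** All members of a class have the same isomorphism type, so taking the union
    gives that type without picking a representative. *)
Definition class_iso_type (c : set (deformation MP)) : set (groupClosed G) :=
  \bigcup_(r in c) iso_type A (deformed r).

Lemma class_iso_typeE (r : deformation MP) :
  class_iso_type (deform_class r) = iso_type A (deformed r).
Proof.
apply/seteqP; split=> [C [R /deform_equivP rR] | C rC].
  by rewrite (iso_type_isomorphic A rR).
by exists r => //; apply/deform_equivP/isomorphic_refl.
Qed.

Lemma class_iso_type_bij :
  set_bij (deform_quotient MP) (complement_types A) class_iso_type.
Proof.
split.
- move=> _ [r _ <-]; rewrite class_iso_typeE.
  have [C cC rC] := deformed_iso_complement r.
  by exists C => //; apply/esym/iso_type_isomorphic.
- move=> c d /set_mem[r _ <-] /set_mem[R _ <-]; rewrite !class_iso_typeE => e.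
  have [C cC rC] := deformed_iso_complement r.
  exact/deform_class_eq/deform_equivP/(iso_type_inj cC rC e).
- move=> _ [K cK <-]; have [r rK] := complement_iso_deformed cK.
  exists (deform_class r); first by exists r.
  by rewrite class_iso_typeE; apply: iso_type_isomorphic.
Qed.

End Complements.

(** * Bijections and cardinality *)

Lemma set_bij_card_eq (T U : Type) (S : set T) (V : set U) (f : T -> U) :
  set_bij S V f -> V #= S.
Proof.
move=> [fS f_inj f_surj].
suff -> : V = f @` S by apply: inj_card_eq.
by apply/seteqP; split=> // _ [x Sx <-]; apply: fS.
Qed.

Theorem theorem2p9 (G : groupType) (A H : groupClosed G)
    (cAH : is_complement A H) :
  let MP := canonical_matched_pair cAH in
  (Equivalence (deform_equiv MP) /\
   exists Phi : set (deformation MP) -> set (groupClosed G),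
     (forall r : deformation MP, Phi (deform_class r) = iso_type A (deformed r)) /\
     set_bij (deform_quotient MP) (complement_types A) Phi) /\
  complement_types A #= deform_quotient MP.
Proof.
move=> MP; split; last exact: set_bij_card_eq (class_iso_type_bij cAH).
split; first exact: deform_equiv_equivalence.
exists (@class_iso_type G A H cAH); split; last exact: class_iso_type_bij.
exact: class_iso_typeE.
Qed.
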